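(* Let $\lambda$ be a nonzero real number. The following identities hold (as formal power series in $t$ with coefficients polynomials in $x$): $$\sum_{n=0}^{\infty}K_{n,\lambda}(x)\frac{t^n}{n!}=\frac{1}{(1-t)^2}e_\lambda^x\left(\frac{t}{(1-t)^2}\right),\qquad \sum_{n=0}^{\infty}J_{n,\lambda}(x)\frac{t^n}{n!}=\frac{1}{1-t}e_\lambda^x\left(\frac{t}{(1-t)^2}\right),\qquad \sum_{n=0}^{\infty}L_{n,\lambda}(x)\frac{t^n}{n!}=e_\lambda^x\left(\frac{t}{(1-t)^2}\right).$$
   Context: $x$ is an indeterminate over the real numbers. For nonzero real $\lambda$, $(x)_{0,\lambda}=1$ and $(x)_{k,\lambda}=x(x-\lambda)(x-2\lambda)\cdots(x-(k-1)\lambda)$ for $k\ge 1$. The degenerate exponential is the formal power series $e_\lambda^x(t)=\sum_{k=0}^{\infty}(x)_{k,\lambda}\frac{t^k}{k!}$. For $n\ge 0$, $K_{n,\lambda}(x)=n!\sum_{k=0}^{n}\binom{n+k+1}{n-k}\frac{(x)_{k,\lambda}}{k!}$; $J_{n,\lambda}(x)=K_{n,\lambda}(x)-nK_{n-1,\lambda}(x)$; and $L_{n,\lambda}(x)=J_{n,\lambda}(x)-nJ_{n-1,\lambda}(x)$, where for $n=0$ the second terms are read as $0$, so $J_{0,\lambda}(x)=L_{0,\lambda}(x)=1$. *)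

(* Defs.v *)
From HB Require Import structures.
From mathcomp Require Import all_boot all_order all_algebra.
From mathcomp Require Import boolp reals.

Set Implicit Arguments.
Unset Strict Implicit.
Unset Printing Implicit Defensive.

Import GRing.Theory.
Local Open Scope ring_scope.

(* A power series is the sequence of its coefficients: f n is the coefficient
   of t^n in f. *)
Record fps (A : Type) := Fps { fps_coef :> nat -> A }.

Lemma fpsP (A : Type) (f g : fps A) : f =1 g <-> f = g.
Proof.
split=> [|-> //]; case: f => f; case: g => g /= fg.
by congr Fps; apply: funext.
Qed.

HB.instance Definition _ (A : Type) := gen_eqMixin (fps A).
HB.instance Definition _ (A : Type) := gen_choiceMixin (fps A).

Section FpsZmodule.
Variable A : zmodType.
Implicit Types f g h : fps A.

Definition fps_zero : fps A := Fps (fun=> 0).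
Definition fps_opp f : fps A := Fps (fun n => - f n).
Definition fps_add f g : fps A := Fps (fun n => f n + g n).

Fact fps_addA : associative fps_add.
Proof. by move=> f g h; apply/fpsP => n /=; rewrite addrA. Qed.
Fact fps_addC : commutative fps_add.
Proof. by move=> f g; apply/fpsP => n /=; rewrite addrC. Qed.
Fact fps_add0 : left_id fps_zero fps_add.
Proof. by move=> f; apply/fpsP => n /=; rewrite add0r. Qed.
Fact fps_addN : left_inverse fps_zero fps_opp fps_add.
Proof. by move=> f; apply/fpsP => n /=; rewrite addNr. Qed.

HB.instance Definition _ :=
  GRing.isZmodule.Build (fps A) fps_addA fps_addC fps_add0 fps_addN.

Lemma fps_coef0 n : (0 : fps A) n = 0. Proof. by []. Qed.
Lemma fps_coefN f n : (- f) n = - f n. Proof. by []. Qed.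
Lemma fps_coefD f g n : (f + g) n = f n + g n. Proof. by []. Qed.
Lemma fps_coefB f g n : (f - g) n = f n - g n. Proof. by []. Qed.

Lemma fps_coef_sum (I : Type) (r : seq I) (P : pred I) (F : I -> fps A) n :
  (\sum_(i <- r | P i) F i) n = \sum_(i <- r | P i) F i n.
Proof. by elim/big_rec2: _ => // i y f _ <-. Qed.

End FpsZmodule.

Section FpsRing.
Variable A : comNzRingType.
Implicit Types f g h : fps A.

Definition fps_one : fps A := Fps (fun n => (n == 0%N)%:R).
Definition fps_mul f g : fps A :=
  Fps (fun n => \sum_(i < n.+1) f i * g (n - i)%N).

Let trunc m f : {poly A} := \poly_(i < m.+1) f i.

Let coef_trunc m f n : (n <= m)%N -> (trunc m f)`_n = f n.
Proof. by move=> le_nm; rewrite coef_poly ltnS le_nm. Qed.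

Let fps_mul_poly m f g (p q : {poly A}) :
  (forall i, (i <= m)%N -> p`_i = f i) ->
  (forall i, (i <= m)%N -> q`_i = g i) ->
  forall i, (i <= m)%N -> (p * q)`_i = fps_mul f g i.
Proof.
move=> pf qg i le_im; rewrite coefM; apply: eq_bigr => j _.
rewrite pf ?qg //; last by rewrite (leq_trans _ le_im) // -ltnS.
exact: leq_trans (leq_subr _ _) le_im.
Qed.

Fact fps_mulA : associative fps_mul.
Proof.
move=> f g h; apply/fpsP => n.
rewrite -(@fps_mul_poly n f (fps_mul g h) (trunc n f)
            (trunc n g * trunc n h)) //; first last.
- by apply: fps_mul_poly => i; apply: coef_trunc.
- exact: coef_trunc.
rewrite mulrA; apply: (@fps_mul_poly n) => //; last exact: coef_trunc.
by apply: fps_mul_poly => i; apply: coef_trunc.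
Qed.

Fact fps_mulC : commutative fps_mul.
Proof.
move=> f g; apply/fpsP => n.
rewrite -(@fps_mul_poly n f g (trunc n f) (trunc n g)) //;
  try exact: coef_trunc.
by rewrite mulrC; apply: (@fps_mul_poly n) => //; apply: coef_trunc.
Qed.

Fact fps_mul1 : left_id fps_one fps_mul.
Proof.
move=> f; apply/fpsP => n /=.
by rewrite big_ord_recl subn0 mul1r big1 ?addr0 // => i _; rewrite mul0r.
Qed.

Fact fps_mulDl : left_distributive fps_mul +%R.
Proof.
move=> f g h; apply/fpsP => n; rewrite fps_coefD /= -big_split /=.
by apply: eq_bigr => i _; rewrite mulrDl.
Qed.

Fact fps_one_neq0 : fps_one != 0.
Proof.
by apply/eqP => /fpsP /(_ 0%N) /eqP; rewrite fps_coef0 /= oner_eq0.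
Qed.

HB.instance Definition _ := GRing.Zmodule_isComNzRing.Build (fps A)
  fps_mulA fps_mulC fps_mul1 fps_mulDl fps_one_neq0.

Lemma fps_coef1 n : (1 : fps A) n = (n == 0%N)%:R. Proof. by []. Qed.

Lemma fps_coefM f g n : (f * g) n = \sum_(i < n.+1) f i * g (n - i)%N.
Proof. by []. Qed.

Lemma fps_coef0M f g : (f * g) 0%N = f 0%N * g 0%N.
Proof. by rewrite fps_coefM big_ord_recl big_ord0 addr0. Qed.

Lemma fps_coefX_lt f k n : f 0%N = 0 -> (n < k)%N -> (f ^+ k) n = 0.
Proof.
move=> f0; elim: k n => // k IHk n; rewrite ltnS => le_nk.
rewrite exprS fps_coefM big_ord_recl f0 mul0r add0r big1 // => i _.
rewrite IHk ?mulr0 // (leq_trans _ le_nk) // ltn_subrL lift0 /=.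
exact: leq_ltn_trans (ltn_ord i).
Qed.

Lemma fps_coef_geom f m n : f 0%N = 0 -> (m < n)%N ->
  (\sum_(k < n) f ^+ k) m = \sum_(k < m.+1) (f ^+ k) m.
Proof.
move=> f0 /subnKC <-; rewrite fps_coef_sum big_split_ord /=.
rewrite [X in _ + X]big1 ?addr0 // => k _.
by rewrite fps_coefX_lt // addSn ltnS leq_addr.
Qed.

Definition fpsC (a : A) : fps A := Fps (fun n => if n is 0 then a else 0).

Lemma fps_coefCM a f n : (fpsC a * f) n = a * f n.
Proof.
by rewrite fps_coefM big_ord_recl subn0 big1 ?addr0 // => i _; rewrite mul0r.
Qed.

Definition fpsX : fps A := Fps (fun n => (n == 1%N)%:R).

(* The composite f (g (t)), meaningful when g has no constant term: then
   g ^+ k has no term of degree less than k, so the sum below is the full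
   coefficient of t^n in the series of the f k * g ^+ k. *)
Definition fps_comp f g : fps A :=
  Fps (fun n => \sum_(k < n.+1) f k * (g ^+ k) n).

End FpsRing.

Section FpsUnitRing.
Variable A : comUnitRingType.
Implicit Types f g h : fps A.

Definition fps_unit : {pred fps A} := fun f => f 0%N \is a GRing.unit.

(* With a the constant term of f and g = 1 - f / a, the inverse of f is
   the sum of the g ^+ k / a. *)
Definition fps_inv f : fps A :=
  if f 0%N \is a GRing.unit then
    Fps (fun n => (f 0%N)^-1 *
      \sum_(k < n.+1) ((1 - fpsC (f 0%N)^-1 * f) ^+ k) n)
  else f.

Fact fps_mulVx : {in fps_unit, left_inverse 1 fps_inv *%R}.
Proof.
move=> f; rewrite unfold_in /fps_inv => uf; rewrite uf.
set a := f 0%N; set g := 1 - fpsC a^-1 * f.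
have g0 : g 0%N = 0.
  by rewrite fps_coefB fps_coefCM fps_coef1 mulVr ?subrr.
apply/fpsP => n.
transitivity ((\sum_(k < n.+1) g ^+ k * (fpsC a^-1 * f)) n).
  rewrite -mulr_suml mulrCA mulrA !fps_coefM; apply: eq_bigr => i _.
  rewrite fps_coefCM /=; congr (_ * _ * _).
  by rewrite (fps_coef_geom g0 (ltn_ord i)).
rewrite -mulr_suml.
have -> : fpsC a^-1 * f = 1 - g by rewrite /g opprB addrC subrK.
have -> : (\sum_(k < n.+1) g ^+ k) * (1 - g) = 1 - g ^+ n.+1.
  by rewrite mulrC -[in RHS](expr1n _ n.+1) subrXX; congr (_ * _);
     apply: eq_bigr => k _; rewrite expr1n mul1r.
by rewrite fps_coefB fps_coefX_lt // subr0.
Qed.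

Fact fps_unitPl f g : g * f = 1 -> fps_unit f.
Proof.
move=> /fpsP /(_ 0%N); rewrite fps_coef0M fps_coef1 /= => gf1.
by apply/unitrPr; exists (g 0%N); rewrite mulrC.
Qed.

Fact fps_inv_out : {in [predC fps_unit], fps_inv =1 id}.
Proof. by move=> f; rewrite inE /= /fps_inv unfold_in => /negbTE ->. Qed.

HB.instance Definition _ := GRing.ComNzRing_hasMulInverse.Build (fps A)
  fps_mulVx fps_unitPl fps_inv_out.

Lemma fps_unitE f : (f \is a GRing.unit) = (f 0%N \is a GRing.unit).
Proof. by []. Qed.

End FpsUnitRing.

Section Degenerate.
Variable R : realType.
Implicit Types (lambda : R) (a : nat -> {poly R}) (n k : nat).

Definition egf a : fps {poly R} := Fps (fun n => (n`!%:R)^-1 *: a n).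

Definition degfall lambda k : {poly R} :=
  \prod_(i < k) ('X - (i%:R * lambda)%:P).

Definition degexp lambda : fps {poly R} := egf (degfall lambda).

Definition degK lambda n : {poly R} :=
  n`!%:R *: \sum_(k < n.+1)
    ('C((n + k + 1)%N, (n - k)%N)%:R / k`!%:R) *: degfall lambda k.

Definition degJ lambda n : {poly R} :=
  degK lambda n - (if n is m.+1 then n%:R *: degK lambda m else 0).

Definition degL lambda n : {poly R} :=
  degJ lambda n - (if n is m.+1 then n%:R *: degJ lambda m else 0).

End Degenerate.

(* Main.v *)
Require Import Defs.
From mathcomp Require Import all_boot all_order all_algebra.
From mathcomp Require Import reals.

Import GRing.Theory.
Local Open Scope ring_scope.

(** Write [u = (1 - t)^-1].  Multiplication by a series distributes over the
    infinite sum that a composite stands for ([fps_coefM_comp]), so the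
    coefficient of [t^n] in [u^2 * e (t * u^2)] is the sum over [k <= n] of
    [(x)_k / k!] times the coefficient of [t^n] in [t^k * u^(2k+2)].  The latter
    is ['C((n - k) + (2k + 1), 2k + 1)] by the negative binomial series
    ([fps_coef_geomX]), which is ['C(n + k + 1, n - k)] by symmetry, as in the
    definition of [K].

    The two other identities follow from the first: the map from [a_n] to
    [a_n - n a_(n-1)] is multiplication of exponential generating functions
    by [1 - t] ([egf_subshift]), and it leads from [K] to [J] and from [J]
    to [L]. *)

Section PowerSeries.
Variable A : comNzRingType.
Implicit Types f g h : fps A.

Lemma fps_coefXM f n : (fpsX A * f) n = if n is m.+1 then f m else 0.
Proof.
case: n => [|m]; first by rewrite fps_coef0M mul0r.
rewrite fps_coefM !big_ord_recl /= mul0r add0r mul1r subSS subn0.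
by rewrite big1 ?addr0 // => i _; rewrite mul0r.
Qed.

Lemma fps_coefXnM f k n : (k <= n)%N -> (fpsX A ^+ k * f) n = f (n - k)%N.
Proof.
elim: k n => [|k IHk] [|n] // le_kn; rewrite ?expr0 ?mul1r ?subn0 //.
by rewrite exprS -mulrA fps_coefXM IHk // subSS.
Qed.

(** The bound [n] may exceed the degree [m]: as [g] has no constant term, the
    terms of index [k > m] do not contribute in degree [m].  One finite sum
    thus gives all the coefficients of the composite up to degree [n]. *)
Lemma fps_coef_comp_trunc f g m n : g 0%N = 0 -> (m <= n)%N ->
  fps_comp f g m = (\sum_(k < n.+1) fpsC (f k) * g ^+ k) m.
Proof.
move=> g0 /subnKC <-; rewrite fps_coef_sum -addSn big_split_ord.
rewrite [X in _ = _ + X]big1 ?addr0; last first.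
  by move=> k _; rewrite fps_coefCM fps_coefX_lt ?mulr0 // ltnS leq_addr.
by apply: eq_bigr => k _; rewrite fps_coefCM.
Qed.

Lemma fps_coefM_comp f g h n : g 0%N = 0 ->
  (h * fps_comp f g) n = \sum_(k < n.+1) f k * (h * g ^+ k) n.
Proof.
move=> g0.
transitivity ((h * \sum_(k < n.+1) fpsC (f k) * g ^+ k) n).
  rewrite !fps_coefM; apply: eq_bigr => i _; congr (_ * _).
  exact: fps_coef_comp_trunc g0 (leq_subr i n).
rewrite mulr_sumr fps_coef_sum; apply: eq_bigr => k _.
by rewrite mulrCA fps_coefCM.
Qed.

End PowerSeries.

Section NegativeBinomial.
Variable A : comUnitRingType.

Lemma fps_unit_1subX : 1 - fpsX A \is a GRing.unit.
Proof. by rewrite fps_unitE fps_coefB fps_coef1 /= subr0 unitr1. Qed.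

(** Pascal's rule says that multiplication by [1 - t] turns the series of the
    ['C(n + k.+1, k.+1)] into that of the ['C(n + k, k)]. *)
Lemma fps_coef_geomX k n :
  ((1 - fpsX A)^-1 ^+ k.+1) n = ('C(n + k, k))%:R.
Proof.
pose F j : fps A := Fps (fun m => ('C(m + j, j))%:R).
suff -> : (1 - fpsX A)^-1 ^+ k.+1 = F k by [].
elim: k => [|k IHk]; apply: (mulrI fps_unit_1subX).
  rewrite expr1 divrr ?fps_unit_1subX //; apply/fpsP => -[|m];
    rewrite mulrBl mul1r fps_coefB fps_coefXM /= !bin0 ?subr0 //.
  by rewrite subrr.
rewrite exprS mulVKr ?fps_unit_1subX // IHk; apply/fpsP => -[|m];
  rewrite mulrBl mul1r fps_coefB fps_coefXM /= ?add0n ?binn ?subr0 //.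
by rewrite addnS binS natrD addSnnS addrAC subrr add0r.
Qed.

End NegativeBinomial.

Section GeneratingFunctions.
Variable R : realType.
Local Notation t := (fpsX {poly R}).

(** Since [n / n! = 1 / (n-1)!], the egf of [n a_(n-1)] is [t] times that of
    [a]. *)
Lemma egf_subshift (a : nat -> {poly R}) :
  egf (fun n => a n - (if n is m.+1 then n%:R *: a m else 0)) =
  (1 - t) * egf a.
Proof.
apply/fpsP => -[|n]; rewrite mulrBl mul1r fps_coefB fps_coefXM /= ?subr0 //.
rewrite scalerBr scalerA factS natrM invfM mulrAC mulVf ?mul1r //.
by rewrite Num.Theory.pnatr_eq0.
Qed.

Lemma egf_degK (lambda : R) :
  egf (degK lambda) =
  1 / (1 - t) ^+ 2 * fps_comp (degexp lambda) (t / (1 - t) ^+ 2).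
Proof.
apply/fpsP => n; rewrite fps_coefM_comp; last by rewrite fps_coef0M mul0r.
rewrite [LHS]/= /degK scalerA mulVf ?scale1r; last first.
  by rewrite Num.Theory.pnatr_eq0 -lt0n fact_gt0.
apply: eq_bigr => k _; have le_kn : (k <= n)%N by rewrite -ltnS.
have -> : 1 / (1 - t) ^+ 2 * (t / (1 - t) ^+ 2) ^+ k
          = t ^+ k * (1 - t)^-1 ^+ (k.*2.+1).+1.
  by rewrite mul1r exprMn mulrCA -!exprVn -exprM -exprD mul2n.
rewrite fps_coefXnM // fps_coef_geomX.
have -> : (n - k + k.*2.+1 = n + k + 1)%N.
  by rewrite addnS -addnn addnA subnK // addn1.
rewrite -(@bin_sub (n + k + 1) k.*2.+1); last first.
  by rewrite -addnn addn1 ltnS leq_add2r.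
have -> : (n + k + 1 - k.*2.+1 = n - k)%N.
  by rewrite addn1 subSS -addnn subnDr.
by rewrite -scalerAl mulr_natr -scaler_nat scalerA mulrC.
Qed.

End GeneratingFunctions.

Theorem mainTheorem11 (R : realType) (lambda : R) (hlambda : lambda != 0) :
  let t : fps {poly R} := fpsX {poly R} in
  [/\ egf (degK lambda) =
        1 / (1 - t) ^+ 2 * fps_comp (degexp lambda) (t / (1 - t) ^+ 2),
      egf (degJ lambda) =
        1 / (1 - t) * fps_comp (degexp lambda) (t / (1 - t) ^+ 2)
    & egf (degL lambda) =
        fps_comp (degexp lambda) (t / (1 - t) ^+ 2)].
Proof.
move=> t; have u1t : 1 - t \is a GRing.unit := fps_unit_1subX _.
have KE := egf_degK R lambda; rewrite -/t in KE.
have JE : egf (degJ lambda) =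
    1 / (1 - t) * fps_comp (degexp lambda) (t / (1 - t) ^+ 2).
  rewrite (egf_subshift R (degK lambda)) KE mulrA; congr (_ * _).
  by rewrite !mul1r -!exprVn expr2 mulVKr.
split=> //.
by rewrite (egf_subshift R (degJ lambda)) JE mul1r mulVKr.
Qed.
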